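(* Let $F$ be a field, $L\ge 1$ an integer, and for $i=1,\ldots,L$ let $b^{(i)}(x),m^{(i)}(x)\in F[x]$ with $\deg m^{(i)}(x)\ge 1$ and $\deg b^{(i)}(x)<\deg m^{(i)}(x)$, and let $\tau^{(i)}\in\mathbb{Z}$ with $0\le\tau^{(i)}\le\deg m^{(i)}(x)$. Then the solution $\Lambda(x)$ of the associated simultaneous partial-inverse (SPI) problem is unique up to a scale factor in $F$: any two solutions differ by a nonzero scalar factor in $F$.
   Context: Here $a(x)\bmod m(x)$ denotes the remainder of the division of $a(x)$ by $m(x)$. The degree of the zero polynomial is $-\infty$. SPI problem: given $b^{(i)}(x),m^{(i)}(x),\tau^{(i)}$ for $i=1,\ldots,L$ as in the claim, find a nonzero polynomial $\Lambda(x)\in F[x]$ of the smallest degree such that $\deg\big(b^{(i)}(x)\Lambda(x)\bmod m^{(i)}(x)\big)<\tau^{(i)}$ for all $i\in\{1,\ldots,L\}$; such a polynomial is called a solution. *)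

(* Defs.v *)
From mathcomp Require Import all_boot all_order all_algebra.
Set Implicit Arguments.
Unset Strict Implicit.
Unset Printing Implicit Defensive.
Import Order.TTheory GRing.Theory Num.Theory.
Local Open Scope ring_scope.

(* deg p < t for an integer bound t, with deg 0 = -oo and
   deg p = (size p).-1 for p != 0. *)
Definition deg_lt (F : fieldType) (p : {poly F}) (t : int) : bool :=
  (p == 0) || ((size p).-1%:Z < t).

Definition SPI_feasible (F : fieldType) (L : nat)
    (b m : 'I_L -> {poly F}) (tau : 'I_L -> int) (Lam : {poly F}) : Prop :=
  Lam != 0 /\ forall i : 'I_L, deg_lt ((b i * Lam) %% m i) (tau i).

(* Feasible polynomials are nonzero, so comparing sizes is comparing degrees. *)
Definition SPI_solution (F : fieldType) (L : nat)
    (b m : 'I_L -> {poly F}) (tau : 'I_L -> int) (Lam : {poly F}) : Prop :=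
  SPI_feasible b m tau Lam /\
  forall P : {poly F}, SPI_feasible b m tau P -> (size Lam <= size P)%N.

(* Main.v *)
Require Import Defs.
From mathcomp Require Import all_boot all_order all_algebra.
Set Implicit Arguments.
Unset Strict Implicit.
Unset Printing Implicit Defensive.
Import Order.TTheory GRing.Theory Num.Theory.
Local Open Scope ring_scope.

(* Scaling one of two solutions to match leading coefficients, the difference
   has smaller degree and still satisfies the (linear) degree constraints, so
   minimality forces it to vanish. *)

(** Taking remainders modulo [m i] is F-linear, so the polynomials meeting all the bounds form an
    F-subspace ([deg_ltB_scale]). Two of its nonzero elements of the same minimal degree must be
    proportional, since otherwise cancelling leading terms ([size_sub_lead_coef]) gives a smaller
    nonzero one. *)

(** Replaces the disjunction by one size bound. Negative [t] must be excluded: [deg_lt 0 t] always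
    holds, whereas [0 <= t] then fails. *)
Lemma deg_lt_size (F : fieldType) (p : {poly F}) (t : int) :
  0 <= t -> deg_lt p t = ((size p)%:Z <= t).
Proof.
case: t => // t _; rewrite /deg_lt lez_nat ltz_nat -size_poly_eq0.
by case: (size p).
Qed.

Lemma deg_ltB_scale (F : fieldType) (p q : {poly F}) (c : F) (t : int) :
  0 <= t -> deg_lt p t -> deg_lt q t -> deg_lt (p - c *: q) t.
Proof.
case: t => // t t0; rewrite !deg_lt_size // !lez_nat => hp hq.
apply: leq_trans (size_polyD _ _) _.
by rewrite size_polyN geq_max hp (leq_trans (size_scale_leq _ _)).
Qed.

Lemma size_sub_lead_coef (F : fieldType) (p q : {poly F}) :
  q != 0 -> size p = size q ->
  (size (p - (lead_coef p / lead_coef q) *: q)%R < size q)%N.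
Proof.
move=> q0 pq; rewrite -(prednK (n := size q)) ?size_poly_gt0 // ltnS.
(* At index [(size q).-1] the two leading terms cancel; above it both polynomials have zero
   coefficients. *)
apply/leq_sizeP => j; rewrite leq_eqVlt => /predU1P[<-|jq].
  by rewrite coefB coefZ -{1}pq -!lead_coefE divfK ?lead_coef_eq0 ?subrr.
have qj : (size q <= j)%N by case: (size q) jq.
by rewrite coefB coefZ !nth_default ?pq // mulr0 subrr.
Qed.

Theorem proposition2 (F : fieldType) (L : nat) (hL : (1 <= L)%N)
    (b m : 'I_L -> {poly F}) (tau : 'I_L -> int)
    (hm : forall i : 'I_L, (1 <= (size (m i)).-1)%N)
    (hb : forall i : 'I_L, deg_lt (b i) (size (m i)).-1%:Z)
    (htau : forall i : 'I_L, 0 <= tau i <= (size (m i)).-1%:Z)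
    (Lam1 Lam2 : {poly F})
    (h1 : SPI_solution b m tau Lam1) (h2 : SPI_solution b m tau Lam2) :
  exists2 c : F, c != 0 & Lam1 = c *: Lam2.
Proof.
case: h1 h2 => -[nz1 f1] min1 [[nz2 f2] min2].
have eq_size : size Lam1 = size Lam2.
  by apply/eqP; rewrite eqn_leq min1 ?min2.
set c := lead_coef Lam1 / lead_coef Lam2.
exists c; first by rewrite mulf_neq0 ?invr_eq0 ?lead_coef_eq0.
apply/eqP; rewrite -subr_eq0; apply/negPn/negP => nzD.
(* A nonzero feasible difference would be shorter than [Lam2], against its minimality. *)
suff /min2 : SPI_feasible b m tau (Lam1 - c *: Lam2).
  by rewrite leqNgt size_sub_lead_coef.
split=> // i; rewrite mulrBr -scalerAr modpD modpN modpZl.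
by case/andP: (htau i) => tau_ge0 _; apply: deg_ltB_scale.
Qed.
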